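(* For every partition $\lambda$, $\hat{S}_{\lambda}$ is an irreducible $\widehat{\mathcal{H}}_{\infty}$-module; that is, the only closed $\widehat{\mathcal{H}}_{\infty}$-invariant subspaces of $\hat{S}_\lambda$ are $0$ and $\hat{S}_\lambda$.
   Context: $\mathbb{F}$ is a field complete with respect to a nontrivial non-archimedean absolute value $|\cdot|$, and $t\in\mathbb{F}$ is fixed with $0<|t|<1$. **Algebras.** $\mathcal{H}_{\infty}$ is the $\mathbb{F}$-algebra generated by $T_1,T_2,\dots$ with relations $(T_i-1)(T_i+t)=0$, $T_iT_{i+1}T_i=T_{i+1}T_iT_{i+1}$, and $T_iT_j=T_jT_i$ for $|i-j|>1$. $\mathcal{H}_n\subset\mathcal{H}_\infty$ is the subalgebra generated by $T_1,\dots,T_{n-1}$; for $\sigma\in\mathfrak{S}_n$ with reduced expression $\sigma=s_{i_1}\cdots s_{i_\ell}$ ($s_i=(i\ i+1)$, $\ell=\ell(\sigma)$) put $T_\sigma=T_{i_1}\cdots T_{i_\ell}$. $\widehat{\mathcal{H}}_{\infty}$ is obtained from $\mathcal{H}_\infty$ by adjoining elements $\epsilon_0,\epsilon_1,\epsilon_2,\dots$ with relations $\epsilon_k^2=\epsilon_k$, $\epsilon_k\epsilon_\ell=\epsilon_{\min\{k,\ell\}}$, $\epsilon_kT_i=T_i\epsilon_k$ for $1\le i\le k-1$, and $\epsilon_kT_j=T_j\epsilon_k=\epsilon_k$ for $j\ge k+1$. **Tableaux.** Partitions are finite weakly decreasing sequences $\lambda=(\lambda_1,\dots,\lambda_\ell)$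 of positive integers (the empty partition is allowed, with $\lambda_1=0$), with $|\lambda|=\sum\lambda_i$. A diagram has boxes $(i,j)$ in row $i$ (counted from the top) and column $j$; the content of $(i,j)$ is $j-i$. Put $n_\lambda=|\lambda|+\lambda_1$, $\lambda^{(n)}=(n-|\lambda|,\lambda)$ for $n\ge n_\lambda$, and $\lambda^{(\infty)}=\bigcup_{n\ge n_\lambda}\lambda^{(n)}$ (infinite first row, then the rows of $\lambda$ below it). $\mathrm{SYT}_\infty(\lambda)$ is the set of bijective fillings $\tau:\lambda^{(\infty)}\to\{1,2,\dots\}$ strictly increasing left to right along rows and top to bottom down columns; $c_\tau(i)$ is the content of the box labeled $i$. $s_i(\tau)$ is $\tau$ with labels $i,i+1$ swapped. Write $s_i(\tau)>\tau$ if $i+1$ lies strictly to the right of and above $i$ in $\tau$, and $s_i(\tau)<\tau$ if $i$ lies strictly to the right of and above $i+1$ in $\tau$ (otherwise $i,i+1$ are in the same row or the same column). **The module $\hat{S}_\lambda$.** $\hat{S}_\lambda=c_0(\mathrm{SYT}_\infty(\lambda))$ is the space of formal sums $\sum_\tau c_\tau e_\tau$, $c_\tau\in\mathbb{F}$, such that for every $c>0$ only finitely many $\tau$ have $|c_\tau|\ge c$, with norm $\sup_\tau|c_\tau|$. The operators $T_i$ are the continuous linear operators with: - $T_ie_\tau=e_\tau$ if $i,i+1$ are in the same row of $\tau$; $T_ie_\tau=-te_\tau$ if in the same column; - if $s_i(\tau)>\tau$: $T_ie_\tau=e_{s_i(\tau)}+\frac{1-t}{1-t^{c_\tau(i+1)-c_\tau(i)}}e_\tau$;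 - if $s_i(\tau)<\tau$, with $d=c_\tau(i)-c_\tau(i+1)$: $T_ie_\tau=t\frac{(1-t^{d-1})(1-t^{d+1})}{(1-t^{d})^2}e_{s_i(\tau)}-t^{d}\frac{1-t}{1-t^{d}}e_\tau$. For $0\le k\le n$ let $\epsilon_k^{(n)}=\frac{1}{[n-k]_t!}\sum_{\sigma}t^{\binom{n-k}{2}-\ell(\sigma)}T_\sigma\in\mathcal{H}_n$, the sum over $\sigma\in\mathfrak{S}_n$ fixing $1,\dots,k$, where $[m]_t!=\prod_{i=1}^m\frac{1-t^i}{1-t}$. The operators $\epsilon_r$ on $\hat S_\lambda$ are $\epsilon_r\left(\sum_\tau c_\tau e_\tau\right)=\sum_\tau c_\tau\lim_{m\to\infty}\epsilon_r^{(r+m)}(e_\tau)$.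
   Formalization: The limit defining ε_r e_τ need not exist in Ŝ_λ (e.g. λ=(1), r=1, label 2 in the second row: all limiting coefficients have absolute value 1); the formal statement sets ε_r e_τ = 0 whenever the limit does not exist. *)

(* Defs.v *)
From HB Require Import structures.
From mathcomp Require Import all_boot all_order all_algebra all_fingroup finmap.
From mathcomp Require Import all_classical all_reals all_analysis.
From mathcomp Require Import summability.

Set Implicit Arguments.
Unset Strict Implicit.
Unset Printing Implicit Defensive.

Import Order.TTheory GRing.Theory Num.Theory.
Import numFieldNormedType.Exports.

Local Open Scope classical_set_scope.
Local Open Scope ring_scope.

Record complete_nonarch (R : realType) (F : fieldType) (abs : F -> R) : Prop := {
  abs_ge0 : forall x, 0 <= abs x;
  abs_eq0 : forall x, abs x = 0 <-> x = 0;
  absM : forall x y, abs (x * y) = abs x * abs y;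
  abs_ultrametric : forall x y, abs (x + y) <= Num.max (abs x) (abs y);
  abs_nontrivial : exists2 x, x != 0 & abs x != 1;
  abs_complete : forall u : nat -> F,
    (forall e : R, 0 < e -> exists N : nat, forall m n : nat,
       (N <= m)%N -> (N <= n)%N -> abs (u m - u n) < e) ->
    exists l : F, abs (u n - l) @[n --> \oo] --> (0 : R) }.

Definition is_partition (la : seq nat) : bool :=
  sorted geq la && (0%N \notin la).

(* A box is (row, column); both are counted from 1. *)
Definition box := (nat * nat)%type.

Definition diagram (mu : seq nat) : set box :=
  [set b | (1 <= b.1)%N /\ (1 <= b.2 <= nth 0%N mu b.1.-1)%N].

Definition content (b : box) : int := b.2%:Z - b.1%:Z.

(* n_la = |la| + la_1, and la^(n) = (n - |la|, la) for n >= n_la *)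
Definition n_min (la : seq nat) : nat := (sumn la + head 0%N la)%N.

Definition padded (la : seq nat) (n : nat) : seq nat := (n - sumn la)%N :: la.

Definition diagram_oo (la : seq nat) : set box :=
  \bigcup_(n in [set n | (n_min la <= n)%N]) diagram (padded la n).

(* A filling is extended by the value 0 outside the diagram, so that two
   tableaux with the same labels are equal as functions. *)
Definition filling := box -> nat.

Definition SYT (la : seq nat) : set filling :=
  [set tau : filling |
    [/\ set_bij (diagram_oo la) [set n | (1 <= n)%N] tau,
        (forall b, ~ diagram_oo la b -> tau b = 0%N),
        (forall i j j', diagram_oo la (i, j) -> diagram_oo la (i, j') ->
           (j < j')%N -> (tau (i, j) < tau (i, j'))%N)
      & (forall i i' j, diagram_oo la (i, j) -> diagram_oo la (i', j) ->
           (i < i')%N -> (tau (i, j) < tau (i', j))%N)]].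

(* the box labeled i; meaningful for i >= 1 *)
Definition box_of (tau : filling) (i : nat) : box :=
  xget (0, 0)%N [set b | tau b = i].

(* the simple transposition s_i = (i i+1) on labels *)
Definition sn (i : nat) (x : nat) : nat :=
  if x == i then i.+1 else if x == i.+1 then i else x.

Definition swap_labels (i : nat) (tau : filling) : filling := sn i \o tau.

Definition qfact (F : fieldType) (t : F) (m : nat) : F :=
  \prod_(1 <= i < m.+1) ((1 - t ^+ i) / (1 - t)).

(* For sigma in S_n, the element x : 'I_n stands for the label x + 1, and
   sigma = s_(i_1) o ... o s_(i_l) for w = [:: i_1; ...; i_l]. *)
Definition expresses (n : nat) (w : seq nat) (sigma : {perm 'I_n}) : Prop :=
  all (fun i => (1 <= i < n)%N) w /\
  forall x : 'I_n, (sigma x).+1 = foldr sn x.+1 w.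

Definition reduced (n : nat) (w : seq nat) (sigma : {perm 'I_n}) : Prop :=
  expresses w sigma /\ forall w', expresses w' sigma -> (size w <= size w')%N.

Definition reduced_word (n : nat) (sigma : {perm 'I_n}) : seq nat :=
  xget [::] [set w | reduced w sigma].

Definition perm_length (n : nat) (sigma : {perm 'I_n}) : nat :=
  size (reduced_word sigma).

Section Module.
Variables (R : realType) (F : fieldType).
Variables (abs : F -> R) (t : F) (la : seq nat).

(* families of coefficients (c_tau), i.e. formal sums \sum_tau c_tau e_tau *)
Definition vec := SYT la -> F^o.

Definition Shat : set vec :=
  [set x | forall c : R, 0 < c -> finite_set [set tau | c <= abs (x tau)]].

(* only used on Shat, where the coefficients are bounded *)
Definition vnorm (x : vec) : R := sup (range (fun tau => abs (x tau))).

(* The basis vector of a filling; it is 0 if the filling is not standard. *)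
Definition evec (f : filling) : vec := fun tau => (val tau == f)%:R.

(* limit of a sequence in Shat, with value 0 if there is no limit *)
Definition vlim (u : nat -> vec) : vec :=
  xget 0 [set y | Shat y /\ vnorm (u m - y) @[m --> \oo] --> (0 : R)].

(* sum of an unordered family in Shat, with value 0 if it does not converge *)
Definition vsum (v : SYT la -> vec) : vec :=
  xget 0 [set y | Shat y /\
    vnorm (partial_sum v B - y) @[B --> totally] --> (0 : R)].

(* \sum_tau c_tau e_tau |-> \sum_tau c_tau v_tau; if the v_tau are bounded this
   is the continuous linear operator with value v_tau at e_tau *)
Definition extend (v : SYT la -> vec) (x : vec) : vec :=
  vsum (fun tau => x tau *: v tau).

(* T_i e_tau, for i >= 1. The last case is s_i(tau) < tau: a standard tableau
   that is in none of the other cases has i to the right of and above i+1. *)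
Definition T_basis (i : nat) (tau : filling) : vec :=
  let p := box_of tau i in
  let q := box_of tau i.+1 in
  if p.1 == q.1 then evec tau
  else if p.2 == q.2 then - t *: evec tau
  else if (q.1 < p.1)%N && (p.2 < q.2)%N then
    evec (swap_labels i tau) + ((1 - t) / (1 - t ^ (content q - content p))) *: evec tau
  else
    let d := content p - content q in
    (t * ((1 - t ^ (d - 1)) * (1 - t ^ (d + 1)) / (1 - t ^ d) ^+ 2))
       *: evec (swap_labels i tau)
    - (t ^ d * ((1 - t) / (1 - t ^ d))) *: evec tau.

Definition T_op (i : nat) : vec -> vec := extend (fun tau => T_basis i (val tau)).

Definition T_word (w : seq nat) (x : vec) : vec := foldr T_op x w.

Definition T_perm (n : nat) (sigma : {perm 'I_n}) : vec -> vec :=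
  T_word (reduced_word sigma).

(* the action of epsilon_k^(n), for k <= n *)
Definition eps_fin (k n : nat) (x : vec) : vec :=
  (qfact t (n - k))^-1 *:
    \sum_(sigma : {perm 'I_n} | [forall y : 'I_n, (y < k)%N ==> (sigma y == y)])
      t ^ ('C(n - k, 2)%:Z - (perm_length sigma)%:Z) *: T_perm sigma x.

(* If eps_fin r (r + m) e_tau has no limit in norm as m -> oo, the value at e_tau
   is 0. This does happen: for la = [:: 1], r = 1 and tau with label 2 in the
   second row, all coefficients of the n-th term at the fillings with label
   b <= n in the second row have absolute value 1. *)
Definition eps (r : nat) : vec -> vec :=
  extend (fun tau => vlim (fun m => eps_fin r (r + m) (evec (val tau)))).

Record is_subspace (W : set vec) : Prop := {
  is_subspace_sub : W `<=` Shat;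
  is_subspace0 : W 0;
  is_subspaceP : forall (a : F) x y, W x -> W y -> W (a *: x + y) }.

Definition norm_closed (W : set vec) : Prop :=
  forall x, Shat x ->
    (forall r : R, 0 < r -> exists2 y, W y & vnorm (x - y) < r) -> W x.

(* The algebra is generated by the T_i, i >= 1, and the epsilon_k, k >= 0, so
   that a subspace is invariant as soon as it is stable under these. *)
Definition Hhat_invariant (W : set vec) : Prop :=
  (forall i x, (1 <= i)%N -> W x -> W (T_op i x)) /\
  (forall k x, W x -> W (eps k x)).

End Module.

Arguments Shat {R F} abs la _.

(* Main.v *)
Require Import Defs.
From mathcomp Require Import all_boot all_order all_algebra finmap.
From mathcomp Require Import all_classical all_reals all_analysis.
From mathcomp Require Import summability zify ring lra.
Import Order.TTheory GRing.Theory Num.Theory.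
Import numFieldNormedType.Exports.
Local Open Scope classical_set_scope.
Local Open Scope ring_scope.

(** Let [W] be a closed invariant subspace. The basis [e_tau] is a joint
    eigenbasis of commuting operators built from the [T_i], with joint
    eigenvalues that separate the tableaux, and this forces [W] to be spanned
    topologically by the [e_tau] that it contains.

    The operators are the Jucys-Murphy elements [J_1 = 1],
    [J_(k+1) = T_k J_k T_k]; [J_k] multiplies [e_tau] by
    [t ^ (k - 1 - c_tau(k))] ([jucys_murphyE]). The content [c_tau(k)] lies
    strictly between [-k] and [k], and [|t| < 1] makes the powers of [t]
    distinct, so Lagrange interpolation at these finitely many values turns
    [J_k] into the operator that keeps the coordinates at the [tau] with a
    prescribed [c_tau(k)] and kills all others ([multiplier_content]). These
    projections preserve [W] and do not increase the norm. A standard tableau is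
    determined by its content sequence ([label_content_ext]). Given [x] in [W]
    with [x_tau <> 0] and [e > 0], only finitely many coordinates of [x] have
    absolute value at least [e]; finitely many projections kill those of them
    at tableaux other than [tau], and leave [x_tau e_tau] up to an error below
    [e].
    As [W] is closed, [e_tau] is in [W] ([subspace_evec]).

    If [s_k(tau)] is standard, it has a nonzero coefficient in [T_k e_tau], so
    that [e_(s_k(tau))] is in [W] as well. Any two standard tableaux are joined
    by such swaps ([swap_connected]), although there are infinitely many labels:
    outside the first row there are only finitely many boxes, and once these
    agree the first rows do. So [W] contains every [e_tau], hence everything.

    On the analytic side, every [T_k] is a two-term operator: it combines the
    coordinates at [tau] and at [s_k(tau)] with coefficients of absolute value at
    most 1. [extend_sparse] evaluates such an operator, given as the norm limit
    of finite partial sums, coordinate by coordinate. *)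

(** * Standard tableaux of the infinite shape *)

Section Diagram.
Variable la : seq nat.

Lemma diagram_ooP (b : box) :
  diagram_oo la b <->
  [/\ (1 <= b.1)%N, (1 <= b.2)%N & (1 < b.1)%N -> (b.2 <= nth 0%N la b.1.-2)%N].
Proof.
case: b => i j; split=> [[n _ []] /= i1 /andP[j1 jn]|[/= i1 j1 jn]].
  by split=> //; case: i i1 jn => [//|[//|i]].
exists (n_min la + j)%N; first by rewrite /= leq_addr.
split=> //=; rewrite j1 /=; case: i i1 jn => [//|[_ _|i _ ->//]] /=.
by rewrite /n_min; lia.
Qed.

(** The shape is a Young diagram, closed under moving up and left; this is where
    the rows of a partition being weakly decreasing is used. *)
Lemma diagram_oo_down (hla : is_partition la) (b b' : box) :
  diagram_oo la b -> (1 <= b'.1 <= b.1)%N -> (1 <= b'.2 <= b.2)%N ->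
  diagram_oo la b'.
Proof.
move=> /diagram_ooP[i1 j1 jn] /andP[i'1 i'i] /andP[j'1 j'j].
apply/diagram_ooP; split=> // i'2.
apply: (leq_trans j'j); apply: (leq_trans (jn (leq_trans i'2 i'i))).
have [h|h] := leqP (size la) b.1.-2; first by rewrite nth_default.
have /andP[srt _] := hla.
have geq_trans : transitive geq by move=> x y z /= xy yz; exact: leq_trans yz xy.
by apply: (sorted_leq_nth geq_trans leqnn 0%N srt); rewrite ?inE; lia.
Qed.

End Diagram.

Section Tableau.
Context {la : seq nat}.
Implicit Types (s : SYT la) (b : box) (k l : nat).

Let D := diagram_oo la.

Definition label s : filling := val s.
Definition box_at s k : box := box_of (label s) k.

Lemma SYTP s : SYT la (label s).
Proof. by have := valP s; rewrite inE. Qed.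

Lemma label_gt0 s b : D b -> (0 < label s b)%N.
Proof. by have [[h _ _] _ _ _] := SYTP s; move/h. Qed.

Lemma label_out s b : ~ D b -> label s b = 0%N.
Proof. by have [_ h _ _] := SYTP s; move/h. Qed.

Lemma box_atK s k : (0 < k)%N -> label s (box_at s k) = k.
Proof.
move=> k0; have [[_ _ sj] _ _ _] := SYTP s.
have [b Db bk] := sj k k0.
exact: (@xgetI _ (0, 0)%N [set b | label s b = k] b bk).
Qed.

Lemma box_at_diagram s k : (0 < k)%N -> D (box_at s k).
Proof.
move=> k0; apply: contrapT => /(label_out s); rewrite box_atK //; lia.
Qed.

Lemma labelK s b : D b -> box_at s (label s b) = b.
Proof.
move=> Db; have [[_ inj _] _ _ _] := SYTP s.
by apply: inj; rewrite ?inE ?box_atK ?label_gt0 //;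
  apply: box_at_diagram; exact: label_gt0.
Qed.

Lemma box_at_inj s k l : (0 < k)%N -> (0 < l)%N -> box_at s k = box_at s l -> k = l.
Proof. by move=> k0 l0 /(congr1 (label s)); rewrite !box_atK. Qed.

Definition label_content s k : int := Defs.content (box_at s k).

Lemma content_inj b b' : Defs.content b = Defs.content b' -> b.1 = b'.1 -> b = b'.
Proof.
by case: b b' => i j [i' j']; rewrite /Defs.content /= => e ii; congr pair => //; lia.
Qed.

Lemma box_at_ext s s' : (forall k, (0 < k)%N -> box_at s k = box_at s' k) -> s = s'.
Proof.
move=> h; apply: val_inj; apply/funext => b.
have [Db|nDb] := pselect (D b); last first.
  by rewrite -/(label s) -/(label s') !label_out.
rewrite -/(label s) -/(label s').
have l0 := label_gt0 s b Db.
by rewrite -{2}(labelK s b Db) h // box_atK.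
Qed.

Definition swappable s k : bool :=
  [&& (0 < k)%N, (box_at s k).1 != (box_at s k.+1).1
    & (box_at s k).2 != (box_at s k.+1).2].

Lemma snK k : involutive (sn k).
Proof. by move=> x; rewrite /sn; do ![case: eqP => //=]; lia. Qed.

Lemma swap_SYT s k : swappable s k -> SYT la (swap_labels k (label s)).
Proof.
case/and3P => k0 ne1 ne2.
have [[lf li ls] lo lr lc] := SYTP s.
have lt b b' : D b -> D b' -> (label s b < label s b')%N ->
    b.1 = b'.1 \/ b.2 = b'.2 -> (sn k (label s b) < sn k (label s b'))%N.
  move=> Db Db' lt e.
  have ne : ~ (label s b = k /\ label s b' = k.+1).
    case=> h1 h2; case: e => e.
      by case/eqP: ne1; rewrite -h2 -h1 !labelK.
    by case/eqP: ne2; rewrite -h2 -h1 !labelK.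
  by rewrite /sn; do ![case: eqP => //=]; lia.
split.
- split.
  + move=> b Db /=; have := label_gt0 s b Db; rewrite /swap_labels /= /sn.
    by do ![case: eqP => //=]; lia.
  + move=> b b' Db Db' /= /(congr1 (sn k)); rewrite /swap_labels /= !snK.
    exact: li.
  + move=> n /= n0; have [|b Db e] := ls (sn k n).
      by rewrite /= /sn; do ![case: eqP => //=]; lia.
    by exists b; rewrite // /swap_labels /= e snK.
- move=> b nDb; rewrite /swap_labels /= lo // /sn.
  by do ![case: eqP => //=]; lia.
- by move=> i j j' Db Db' jj; apply: lt; [| |exact: lr|left].
- by move=> i i' j Db Db' jj; apply: lt; [| |exact: lc|right].
Qed.

(** Tableaux whose swap is not standard are left fixed, which makes [swap k] a
    total involution. *)
Definition swap k s : SYT la :=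
  if swappable s k then insubd s (swap_labels k (label s)) else s.

Lemma label_swap s k : swappable s k -> label (swap k s) = swap_labels k (label s).
Proof.
move=> h; rewrite /swap h /label val_insubd.
by have /mem_set -> := swap_SYT s k h.
Qed.

Lemma box_at_swap s k l : swappable s k -> (0 < l)%N ->
  box_at (swap k s) l = box_at s (sn k l).
Proof.
move=> h l0; have k0 : (0 < k)%N by case/and3P: h.
have sl0 : (0 < sn k l)%N by rewrite /sn; do ![case: eqP => //=]; lia.
have Db := box_at_diagram s _ sl0.
have := labelK (swap k s) _ Db.
by rewrite label_swap // /swap_labels /= box_atK // snK.
Qed.

Lemma sn_eq k : sn k k = k.+1. Proof. by rewrite /sn eqxx. Qed.
Lemma sn_eqS k : sn k k.+1 = k. Proof. by rewrite /sn eqxx; case: eqP => //; lia. Qed.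

Lemma swappable_swap s k : swappable (swap k s) k = swappable s k.
Proof.
case h : (swappable s k); last by rewrite /swap h h.
case/and3P: (h) => k0 ne1 ne2.
by rewrite /swappable !box_at_swap // sn_eq sn_eqS k0 eq_sym ne1 eq_sym ne2.
Qed.

Lemma swapK k : involutive (swap k).
Proof.
move=> s; case h : (swappable s k); last by rewrite /swap h h.
apply: val_inj; rewrite -/(label _) label_swap ?swappable_swap //.
by rewrite label_swap //; apply/funext => b; rewrite /swap_labels /= snK.
Qed.

Lemma label_content_swap s k : swappable s k ->
  label_content (swap k s) k = label_content s k.+1.
Proof.
by move=> h; case/and3P: (h) => k0 _ _; rewrite /label_content box_at_swap // sn_eq.
Qed.

Lemma label_content_swapS s k : swappable s k ->
  label_content (swap k s) k.+1 = label_content s k.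
Proof.
by move=> h; case/and3P: (h) => k0 _ _; rewrite /label_content box_at_swap // sn_eqS.
Qed.

End Tableau.

Section Partition.
Context {la : seq nat} (hla : is_partition la).
Implicit Types (s : SYT la) (b : box) (k l : nat).

Let D := diagram_oo la.

(** The tableau conditions compare boxes of one row or of one column; two boxes in
    weakly south-east position are compared through the corner of the rectangle
    that they span. *)
Lemma label_lt s b b' : D b -> D b' -> (b.1 <= b'.1)%N -> (b.2 <= b'.2)%N ->
  b != b' -> (label s b < label s b')%N.
Proof.
have [_ _ row col] := SYTP s.
case: b b' => [i j] [i' j'] Db Db' /= ii jj.
rewrite xpair_eqE negb_and !neq_ltn !(ltnNge i') ii !(ltnNge j') jj !orbF.
have Dc : D (i', j).
  move/diagram_ooP: (Db) (Db') => [/= i1 j1 _] /diagram_ooP[/= i'1 j'1 _].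
  by apply: (diagram_oo_down _ _ _ _ Db') => //=; lia.
case: (ltnP i i') => [ii' _|ii' /= jj'].
  have lt1 := col _ _ _ Db Dc ii'; apply: (leq_trans lt1).
  by move: jj; rewrite leq_eqVlt => /orP[/eqP<-//|jj]; exact/ltnW/row.
have -> : i = i' by lia.
by apply: row => //.
Qed.

Lemma label_le s b b' : D b -> D b' -> (b.1 <= b'.1)%N -> (b.2 <= b'.2)%N ->
  (label s b <= label s b')%N.
Proof.
move=> Db Db' h1 h2; have [->//|ne] := eqVneq b b'.
exact/ltnW/label_lt.
Qed.

Lemma row_le_label s i j : D (i, j) -> (i <= label s (i, j))%N.
Proof.
elim: i => // -[_ Db|i IH Db]; first exact: label_gt0.
have Dc : D (i.+1, j).
  move/diagram_ooP: (Db) => [/= _ j1 _].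
  by apply: (diagram_oo_down _ hla _ _ Db); rewrite /= ?j1 /=.
apply: (leq_ltn_trans (IH Dc)); apply: label_lt => //=.
by rewrite xpair_eqE; lia.
Qed.

Lemma column_le_label s i j : D (i, j) -> (j <= label s (i, j))%N.
Proof.
elim: j => // -[_ Db|j IH Db]; first exact: label_gt0.
have Dc : D (i, j.+1).
  move/diagram_ooP: (Db) => [/= i1 _ _].
  by apply: (diagram_oo_down _ hla _ _ Db); rewrite /= ?i1 /=.
apply: (leq_ltn_trans (IH Dc)); apply: label_lt => //=.
by rewrite xpair_eqE; lia.
Qed.

(** The box labeled [k] has at most [k] boxes weakly to its left, and at most [k]
    weakly above it. This makes the interpolation in the content a finite one. *)
Lemma label_content_bound s k : (0 < k)%N -> (- k%:Z < label_content s k < k%:Z)%R.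
Proof.
move=> k0; rewrite /label_content /Defs.content.
have := box_atK s k k0; have := box_at_diagram s k k0.
case: (box_at s k) => i j Db e /=.
have /diagram_ooP[/= i1 j1 _] := Db.
have := row_le_label s i j Db; have := column_le_label s i j Db.
rewrite e; lia.
Qed.

Lemma diagonal_lt s b b' : D b -> D b' -> Defs.content b = Defs.content b' ->
  (b.1 < b'.1)%N -> (label s b < label s b')%N.
Proof.
move=> Db Db' /eqP; rewrite /Defs.content => /eqP e lt1.
by apply: label_lt => //; [exact: ltnW|lia|apply: contraTneq lt1 => ->; rewrite ltnn].
Qed.

(** Labels increase along diagonals, and the content of a label names its
    diagonal; so the box of [k] is the first box of that diagonal that is not
    taken by a smaller label. *)
Lemma label_content_ext s s' :
  (forall k, (0 < k)%N -> label_content s k = label_content s' k) -> s = s'.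
Proof.
move=> h; apply: box_at_ext => k.
have [n] := ubnP k; elim: n k s s' h => // n IH k s s' h kn k0.
(* By symmetry, [u] is the tableau in which [k] sits higher on its diagonal; then
   [u'] has a smaller label in that box. *)
suff F (u u' : SYT la) :
    (forall k, (0 < k)%N -> label_content u k = label_content u' k) ->
    ((box_at u k).1 < (box_at u' k).1)%N -> False.
  apply: content_inj (h k k0) _.
  by case: (ltngtP (box_at s k).1 (box_at s' k).1) => // /F[] // l l0; rewrite h.
move=> {}h lt1; have Db := box_at_diagram u k k0.
have lt : (label u' (box_at u k) < k)%N.
  rewrite -[in X in (_ < X)%N](box_atK u' k k0); apply: diagonal_lt lt1 => //.
    exact: box_at_diagram.
  exact: h.
have l0 := label_gt0 u' _ Db.
have := IH _ u u' h (leq_trans lt _) l0.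
rewrite (labelK u') // => /(_ kn) /(box_at_inj u _ _ l0 k0) e.
by move: lt; rewrite e ltnn.
Qed.

(** A box strictly between two comparable boxes would need a label strictly
    between [k] and [k+1]. So comparable boxes with these labels are adjacent. *)
Lemma consecutive_lt s k : (0 < k)%N ->
  ((box_at s k).1 <= (box_at s k.+1).1)%N ->
  ((box_at s k).2 <= (box_at s k.+1).2)%N ->
  [\/ (box_at s k.+1) = ((box_at s k).1, (box_at s k).2.+1) | 
      (box_at s k.+1) = ((box_at s k).1.+1, (box_at s k).2)].
Proof.
move=> k0 le1 le2.
have Dp := box_at_diagram s _ k0; have Dq := box_at_diagram s k.+1 isT.
have ep := box_atK s _ k0; have eq := box_atK s k.+1 isT.
have /diagram_ooP[/= p1 p2 _] := Dp; have /diagram_ooP[/= q1 q2 _] := Dq.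
have between b : D b -> ((box_at s k).1 <= b.1 <= (box_at s k.+1).1)%N ->
    ((box_at s k).2 <= b.2 <= (box_at s k.+1).2)%N ->
    b = box_at s k \/ b = box_at s k.+1.
  move=> Db /andP[b1 b1'] /andP[b2 b2'].
  have [->|ne] := eqVneq b (box_at s k); first by left.
  have [->|ne'] := eqVneq b (box_at s k.+1); first by right.
  rewrite eq_sym in ne.
  have := label_lt s _ _ Dp Db b1 b2 ne; have := label_lt s _ _ Db Dq b1' b2' ne'.
  by rewrite ep eq; lia.
have down b : ((box_at s k).1 <= b.1 <= (box_at s k.+1).1)%N ->
    ((box_at s k).2 <= b.2 <= (box_at s k.+1).2)%N -> D b.
  by move=> /andP[b1 b1'] /andP[b2 b2']; apply: (diagram_oo_down _ hla _ _ Dq); lia.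
have ne : box_at s k <> box_at s k.+1.
  by move=> /(congr1 (label s)); rewrite ep eq; lia.
move: ne between down le1 le2.
case: (box_at s k) (box_at s k.+1) => i j [i' j'] /= ne bt dn le1 le2.
have [jj|jj] := ltnP j j'.
  have [|||[h1]|<-] := bt (i, j.+1); rewrite /= ?leqnn ?le1 ?jj ?leqnSn //.
  - by apply: dn => /=; lia.
  - by lia.
  - by left.
have ejj : j' = j by lia.
have ii : (i < i')%N.
  by rewrite ltn_neqAle le1 andbT; apply/eqP => e; apply: ne; rewrite e ejj.
have [|||[h1]|<-] := bt (i.+1, j); rewrite /= ?leqnn ?le2 ?ii ?leqnSn //.
- by apply: dn => /=; lia.
- by lia.
- by right.
Qed.

(** The four relative positions of [k] and [k+1], with whether the two labels may be
    swapped and the axial distance [c(k+1) - c(k)]. In the last two cases the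
    distance is at least 2 in absolute value, so that the coefficient of the
    swapped tableau in [T_k e_s] does not vanish. *)
Variant consecutive_spec s k : bool -> int -> Type :=
| SameRow of (box_at s k).1 = (box_at s k.+1).1 :
    consecutive_spec s k false 1
| SameColumn of (box_at s k).1 <> (box_at s k.+1).1
    & (box_at s k).2 = (box_at s k.+1).2 :
    consecutive_spec s k false (-1)
| Above (n : nat) of ((box_at s k.+1).1 < (box_at s k).1)%N
    & ((box_at s k).2 < (box_at s k.+1).2)%N :
    consecutive_spec s k true n.+2%:Z
| Below (n : nat) of ((box_at s k).1 < (box_at s k.+1).1)%N
    & ((box_at s k.+1).2 < (box_at s k).2)%N :
    consecutive_spec s k true (- n.+2%:Z).

Lemma consecutiveP s k : (0 < k)%N ->
  consecutive_spec s k (swappable s k) (label_content s k.+1 - label_content s k).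
Proof.
move=> k0; have := consecutive_lt s k k0.
have := label_le s _ _ (box_at_diagram s k.+1 isT) (box_at_diagram s k k0).
rewrite !box_atK // ltnn; rewrite /swappable k0 /= /label_content /Defs.content.
set p := box_at s k; set q := box_at s k.+1 => qp pq.
have [e1|/eqP ne1] := eqVneq p.1 q.1.
  have -> : ((q.2%:Z - q.1%:Z) - (p.2%:Z - p.1%:Z) = 1)%R; last exact: SameRow.
  have [le2|lt2] := leqP p.2 q.2; last by have : false by apply: qp; lia.
  have [e|e] := pq (eq_leq e1) le2; first by rewrite e /=; lia.
  by move: e1; rewrite e /=; lia.
have [e2|/eqP ne2] := eqVneq p.2 q.2.
  have -> : ((q.2%:Z - q.1%:Z) - (p.2%:Z - p.1%:Z) = -1)%R; last exact: SameColumn.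
  have [le1|lt1] := leqP p.1 q.1; last by have : false by apply: qp; lia.
  have [e|e] := pq le1 (eq_leq e2); last by rewrite e /=; lia.
  by move: e2; rewrite e /=; lia.
case h : ((q.1 < p.1) && (p.2 < q.2))%N.
  have -> : ((q.2%:Z - q.1%:Z) - (p.2%:Z - p.1%:Z) =
             ((q.2 - p.2) + (p.1 - q.1)).-2.+2%:Z)%R.
    by lia.
  by case/andP: h => *; apply: Above.
have [h1 h2] : (p.1 < q.1)%N /\ (q.2 < p.2)%N.
  have [le1|lt1] := leqP q.1 p.1.
    have [le2|lt2] := leqP q.2 p.2; first by have : false by apply: qp; lia.
    by move: h; rewrite lt2 andbT; lia.
  have [le2|lt2] := leqP p.2 q.2; last by [].
  by have [e|e] := pq (ltnW lt1) le2; move: ne1 ne2; rewrite e /=; lia.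
have -> : ((q.2%:Z - q.1%:Z) - (p.2%:Z - p.1%:Z) =
           - ((p.2 - q.2) + (q.1 - p.1)).-2.+2%:Z)%R.
  by lia.
exact: Below.
Qed.

End Partition.

(** * Any two standard tableaux are joined by swaps *)

Section Connected.
Context {la : seq nat} (hla : is_partition la).
Implicit Types (s r : SYT la) (b : box) (k l n : nat).

Let D := diagram_oo la.

Definition agree r n s := forall b, D b -> (label r b <= n)%N -> label s b = label r b.

Lemma agreeC r n s : agree r n s -> agree s n r.
Proof.
move=> h b Db le; have l0 := label_gt0 s b Db.
have Db' := box_at_diagram r _ l0.
have e := h _ Db'; rewrite box_atK // in e.
have : box_at s (label s (box_at r (label s b))) = box_at s (label s b) by rewrite e.
by rewrite !labelK // => E; rewrite -[in LHS]E box_atK.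
Qed.

(** Only finitely many boxes lie outside the first row. *)
Lemma lower_bounded r : exists N, forall b, D b -> (1 < b.1)%N -> (label r b <= N)%N.
Proof.
exists (\max_(i < size la) \max_(j < (nth 0%N la i).+1) label r (i.+2, nat_of_ord j))%N.
move=> [[|[|i]] j] //= /diagram_ooP[/= _ j1 /(_ isT) jn] _.
have isz : (i < size la)%N.
  by rewrite ltnNge; apply/negP => h; move: jn; rewrite nth_default //; lia.
have jlt : (j < (nth 0%N la i).+1)%N by [].
apply: (leq_trans _ (leq_bigmax (Ordinal isz))) => /=.
exact: (leq_trans _ (leq_bigmax (Ordinal jlt))).
Qed.

(** Once all the labels below the first row are placed, the others can only fill
    the first row from left to right. *)
Lemma agree_eq r s N : (forall b, D b -> (1 < b.1)%N -> (label r b <= N)%N) ->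
  agree r N s -> s = r.
Proof.
move=> low ag.
have agm m : agree r (N + m)%N s.
  elim: m => [|m IH]; first by rewrite addn0.
  move: IH; rewrite addnS; set n := (N + m)%N => IH b Db.
  rewrite leq_eqVlt => /orP[/eqP e|]; last by rewrite ltnS; exact: IH.
  have n0 : (0 < n.+1)%N by [].
  have DB := box_at_diagram s _ n0; have eB := box_atK s _ n0.
  set B := box_at s n.+1 in DB eB.
  have rB : (n < label r B)%N.
    rewrite ltnNge; apply/negP => h; have := IH _ DB h.
    by rewrite eB => E; rewrite -E ltnn in h.
  have row1 c : D c -> (n < label r c)%N -> c.1 = 1%N.
    move=> Dc nc; have /diagram_ooP[c1 _ _] := Dc.
    have [c2|] := ltnP 1%N c.1; last by lia.
    by have := low _ Dc c2; rewrite /n in nc; lia.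
  have bB : b.1 = B.1 by rewrite !row1 // e.
  have sb : (n < label s b)%N.
    by rewrite ltnNge; apply/negP => h; have := agreeC _ _ _ IH _ Db h; rewrite e; lia.
  rewrite e.
  case: (leqP b.2 B.2) => le2.
    by have := label_le hla s b B Db DB (eq_leq bB) le2; rewrite eB; lia.
  have := label_le hla r B b DB Db (eq_leq (esym bB)) (ltnW le2); rewrite e => h.
  have {}h : label r B = n.+1 by lia.
  have : box_at r (label r B) = box_at r (label r b) by rewrite h e.
  by rewrite !labelK // => <-.
apply: val_inj; apply/funext => b; rewrite -/(label s) -/(label r).
have [Db|nDb] := pselect (D b); last by rewrite !label_out.
by apply: (agm (label r b)) => //; exact: leq_addl.
Qed.

Variable U : set (SYT la).
Hypothesis Uswap : forall s k, swappable s k -> U s -> U (swap k s).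

(** If [s] agrees with [r] up to [n], and the box of [n+1] in [r] has label [k+1] in
    [s] with [k > n], then [k] sits in a box with a larger label in [r]. The two
    boxes are therefore in the wrong order for [r] and cannot share a row or a
    column; swapping [k] and [k+1] brings the label of that box closer to [n+1]. *)
Lemma agree_step r n s : U s -> agree r n s -> exists2 s', U s' & agree r n.+1 s'.
Proof.
move=> Us ag; have n0 : (0 < n.+1)%N by [].
have DB := box_at_diagram r _ n0; have eB := box_atK r _ n0.
set B := box_at r n.+1 in DB eB.
have [d] : exists d, label s B = (n.+1 + d)%N.
  exists (label s B - n.+1)%N; rewrite subnKC // ltnNge; apply/negP => h.
  by have := agreeC _ _ _ ag _ DB h; rewrite eB; lia.
elim: d s Us ag => [|d IH] s Us ag sB.
  exists s => // b Db; rewrite leq_eqVlt => /orP[/eqP e|]; last exact: ag.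
  by rewrite -(labelK r b Db) e -/B sB eB addn0.
have k0 : (0 < n.+1 + d)%N by [].
move: sB k0; rewrite addnS; set k := (n.+1 + d)%N => sB k0.
have eBk : box_at s k.+1 = B by rewrite -sB labelK.
have DC := box_at_diagram s _ k0; have eC := box_atK s _ k0.
set C := box_at s k in DC eC.
have rC : (n.+1 < label r C)%N.
  rewrite ltnNge leq_eqVlt; apply/negP => /orP[/eqP h|h].
    have : box_at r (label r C) = B by rewrite h.
    by rewrite labelK // => CB; move: sB; rewrite -CB eC; lia.
  by have := ag _ DC h; rewrite eC; rewrite /k; lia.
have CB : ~ ((C.1 <= B.1)%N /\ (C.2 <= B.2)%N).
  by case=> h1 h2; have := label_le hla r C B DC DB h1 h2; rewrite eB; lia.
have BC : ~ ((B.1 <= C.1)%N /\ (B.2 <= C.2)%N).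
  by case=> h1 h2; have := label_le hla s B C DB DC h1 h2; rewrite eC sB; lia.
have sw : swappable s k.
  by rewrite /swappable k0 eBk -/C /=; apply/andP; split; apply/eqP => e; lia.
apply: (IH (swap k s)).
- exact: Uswap.
- move=> b Db le; rewrite label_swap // /swap_labels /= ag // /sn.
  by do ![case: eqP => //]; rewrite /k; lia.
- by rewrite label_swap // /swap_labels /= sB sn_eqS.
Qed.

(** Stated for a set [U] of tableaux stable under swaps, to be applied to the [s]
    with [e_s] in the invariant subspace. *)
Lemma swap_connected r s : U s -> U r.
Proof.
move=> Us; have [N low] := lower_bounded r.
suff [s' Us' ag] : exists2 s', U s' & agree r N s' by rewrite -(agree_eq r s' N low ag).
elim: N {low} => [|N [s' Us' ag]]; last exact: agree_step ag.
exists s => // b Db; have := label_gt0 r b Db; lia.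
Qed.

End Connected.

(** * Non-archimedean absolute values *)

Section Absolute.
Context {R : realType} {F : fieldType} {abs : F -> R}.
Hypothesis habs : complete_nonarch abs.

Lemma abs0 : abs 0 = 0.
Proof. exact/(abs_eq0 habs). Qed.

Lemma abs_gt0 x : x != 0 -> 0 < abs x.
Proof.
by move=> x0; rewrite lt_def (abs_ge0 habs) andbT; apply: contra_neq x0 => /(abs_eq0 habs).
Qed.

Lemma abs1 : abs 1 = 1.
Proof.
have := absM habs 1 1; rewrite mulr1 => /esym e.
apply: (mulfI (lt0r_neq0 (abs_gt0 _ (oner_neq0 F)))).
by rewrite mulr1.
Qed.

Lemma absN x : abs (- x) = abs x.
Proof.
have h : abs (- 1) = 1.
  have /eqP := absM habs (-1) (-1); rewrite mulrNN mulr1 abs1 eq_sym -expr2 sqrf_eq1.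
  by case/orP => /eqP // e; have := abs_ge0 habs (-1); rewrite e; lra.
by rewrite -mulN1r (absM habs) h mul1r.
Qed.

Lemma absX x n : abs (x ^+ n) = abs x ^+ n.
Proof. by elim: n => [|n IH]; rewrite ?expr0 ?abs1 // !exprS (absM habs) IH. Qed.

Lemma absV x : abs x^-1 = (abs x)^-1.
Proof.
have [->|x0] := eqVneq x 0; first by rewrite !invr0 abs0 invr0.
have a0 := lt0r_neq0 (abs_gt0 _ x0).
by apply: (mulfI a0); rewrite -(absM habs) !divff // abs1.
Qed.

Lemma abs_addr_le x y c : abs x <= c -> abs y <= c -> abs (x + y) <= c.
Proof.
by move=> hx hy; apply: (le_trans (abs_ultrametric habs x y)); rewrite ge_max hx.
Qed.

Lemma abs_subr_le x y c : abs x <= c -> abs y <= c -> abs (x - y) <= c.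
Proof. by move=> hx hy; apply: abs_addr_le; rewrite ?absN. Qed.

(** The isosceles property: a perturbation of norm below 1 does not change the
    norm of 1. *)
Lemma abs_1sub x : abs x < 1 -> abs (1 - x) = 1.
Proof.
move=> x1; apply/eqP; rewrite eq_le abs_subr_le ?abs1 ?(ltW x1) //=.
rewrite leNgt; apply/negP => h.
have : abs 1 <= Num.max (abs (1 - x)) (abs x).
  by apply: le_trans (abs_ultrametric habs _ _); rewrite subrK.
by rewrite abs1 le_max !leNgt h x1.
Qed.

Context {t : F} (ht : 0 < abs t < 1).

Lemma t_neq0 : t != 0.
Proof. by case/andP: ht => h _; apply: contraTneq h => ->; rewrite abs0 ltxx. Qed.

Lemma abs_tX_lt1 n : abs (t ^+ n.+1) < 1.
Proof. by case/andP: ht => t0 t1; rewrite absX exprn_ilt1 // ltW. Qed.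

Lemma abs_1subtX n : abs (1 - t ^+ n.+1) = 1.
Proof. exact/abs_1sub/abs_tX_lt1. Qed.

Lemma sub1tX_neq0 n : 1 - t ^+ n.+1 != 0.
Proof. by apply/eqP => /(abs_eq0 habs); rewrite abs_1subtX; apply/eqP/oner_neq0. Qed.

Lemma exprz_injective : injective (fun z : int => t ^ z).
Proof.
suff F0 (z w : int) : (z < w)%R -> t ^ z <> t ^ w.
  by move=> z w /= e; case: (ltgtP z w) => // /F0; rewrite e.
move=> zw e; have [n wz] : exists n : nat, w = z + n.+1%:Z.
  by exists (`|w - z|%N.-1); lia.
have := sub1tX_neq0 n; move: e; rewrite wz expfzDr ?t_neq0 // -exprnP => e.
have tz : t ^ z != 0 by rewrite expfz_neq0 // t_neq0.
by rewrite subr_eq0 => /eqP; apply; apply: (mulfI tz); rewrite mulr1.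
Qed.

End Absolute.

(** * Null families and operators with two terms *)

Section Vectors.
Context {R : realType} {F : fieldType} {abs : F -> R}.
Hypothesis habs : complete_nonarch abs.
Context {la : seq nat}.
Implicit Types (x y : vec F la) (s r : SYT la) (f : SYT la -> SYT la).

Lemma evecE s r : evec F (label s) r = (r == s)%:R.
Proof. by []. Qed.

(** The supremum that defines [vnorm] takes the value 0 on unbounded sets, so
    boundedness is needed to read coordinates off the norm. *)
Lemma Shat_bounded x : Shat abs la x -> has_ubound (range (fun s => abs (x s))).
Proof.
move=> /(_ 1 ltr01) /finite_fsetP[A eA].
exists (1 + \sum_(s <- A) abs (x s)) => _ [s _ <-].
have h0 : 0 <= \sum_(s <- A) abs (x s) by apply: sumr_ge0 => ? _; exact: (abs_ge0 habs).
have [h|h] := leP 1 (abs (x s)); last by apply: (le_trans (ltW h)); rewrite lerDl.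
have sA : s \in A by have : [set s | 1 <= abs (x s)] s by []; rewrite eA.
rewrite (big_rem s) //= addrCA lerDl addr_ge0 // sumr_ge0 // => ? _.
exact: (abs_ge0 habs).
Qed.

Lemma vnorm_ge x s : Shat abs la x -> abs (x s) <= vnorm abs x.
Proof. by move=> /Shat_bounded ub; apply: ub_le_sup => //; exists s. Qed.

Lemma vnorm_le x (c : R) : 0 <= c -> (forall s, abs (x s) <= c) -> vnorm abs x <= c.
Proof.
move=> c0 h; rewrite /vnorm.
have [->|/set0P ne] := eqVneq (range (fun s => abs (x s))) set0; first by rewrite sup0.
by apply: ge_sup => // _ [s _ <-].
Qed.

Lemma vnorm_ge0 x : 0 <= vnorm abs x.
Proof.
rewrite /vnorm; have [->|/set0P[_ [s _ _]]] :=
  eqVneq (range (fun s => abs (x s))) set0; first by rewrite sup0.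
have [/ub_le_sup h|nh] := pselect (has_ubound (range (fun s => abs (x s)))).
  by apply: (le_trans (abs_ge0 habs (x s))); apply: h; exists s.
by rewrite sup_out // => -[_ /nh].
Qed.

Lemma Shat_dominated f x y : involutive f -> Shat abs la x ->
  (forall s, abs (y s) <= Num.max (abs (x s)) (abs (x (f s)))) -> Shat abs la y.
Proof.
move=> fK Sx h c c0; have fin := Sx c c0.
apply: (@sub_finite_set _ _ ([set s | c <= abs (x s)] `|` f @` [set s | c <= abs (x s)])).
  move=> s /= cy; have := le_trans cy (h s); rewrite le_max => /orP[|] hs; [left|right] => //.
  by exists (f s); rewrite ?fK.
by rewrite finite_setU; split=> //; exact: finite_image.
Qed.

Lemma Shat_sub x y : Shat abs la x -> Shat abs la y -> Shat abs la (x - y).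
Proof.
move=> Sx Sy c c0; have := Sx c c0; have := Sy c c0 => h1 h2.
apply: (@sub_finite_set _ _ ([set s | c <= abs (x s)] `|` [set s | c <= abs (y s)])).
  move=> s /= h; have := le_trans h (abs_ultrametric habs (x s) (- y s)).
  by rewrite (absN habs) le_max => /orP[]; [left|right].
by rewrite finite_setU.
Qed.

Lemma Shat_evec (a : F) s : Shat abs la (a *: evec F (label s)).
Proof.
move=> c c0; apply: (@sub_finite_set _ _ [set s]); last exact: finite_set1.
move=> r /= h; apply: contrapT => /eqP rs; move: h.
rewrite [X in abs X](_ : _ = 0) ?(abs0 habs) ?leNgt ?c0 //.
by rewrite /GRing.scale /= evecE (negbTE rs) scaler0.
Qed.

(** Convergence along finite sets, unfolded. The weak inequality matches the bounds
    that a supremum yields. *)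
Definition tends_to (u : {fset SYT la} -> vec F la) y :=
  forall e : R, 0 < e -> exists A : {fset SYT la},
    forall B : {fset SYT la}, (A `<=` B)%fset -> vnorm abs (u B - y) <= e.

Lemma tends_toP (u : {fset SYT la} -> vec F la) y :
  vnorm abs (u B - y) @[B --> totally] --> (0 : R) <-> tends_to u y.
Proof.
split=> [/cvgr0Pnorm_lt h e e0|h].
  have [A _ hA] := h (totally_filter) e e0.
  exists A => B AB; have := hA B AB => /=.
  by rewrite ger0_norm ?vnorm_ge0 // => /ltW.
apply/(@cvgr0Pnorm_lt _ _ _ _ totally_filter) => e e0.
have e20 : 0 < (e : R) / 2 by rewrite divr_gt0.
have [A hA] := h _ e20.
exists A => // B AB /=; rewrite ger0_norm ?vnorm_ge0 //.
by apply: (le_lt_trans (hA B AB)); rewrite gtr_pMr // invf_lt1 // ltr1n.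
Qed.

Lemma tends_to_unique u y z : (forall B, Shat abs la (u B)) ->
  Shat abs la y -> Shat abs la z -> tends_to u y -> tends_to u z -> z = y.
Proof.
move=> Su Sy Sz hy hz; apply/funext => s; apply/eqP; rewrite -subr_eq0; apply/eqP.
apply/(abs_eq0 habs); apply/eqP; rewrite eq_le (abs_ge0 habs) andbT.
apply/ler_addgt0Pl => e e0; rewrite addr0.
have [A hA] := hy e e0; have [B hB] := hz e e0.
have {}hA := hA (A `|` B)%fset (fsubsetUl _ _).
have {}hB := hB (A `|` B)%fset (fsubsetUr _ _).
have -> : z s - y s = (u (A `|` B)%fset - y) s - (u (A `|` B)%fset - z) s.
  by rewrite !fctE opprB addrC addrA subrK.
apply: (abs_subr_le habs).
  by apply: le_trans hA; apply: vnorm_ge; exact: Shat_sub.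
by apply: le_trans hB; apply: vnorm_ge; exact: Shat_sub.
Qed.

Lemma sum_delta (A : {fset SYT la}) (g : SYT la -> F) f s : involutive f ->
  \sum_(i <- A) g i * (s == f i)%:R = if f s \in A then g (f s) else 0.
Proof.
move=> fK; case: ifPn => [sA|sA].
  rewrite (big_rem (f s)) //= fK eqxx mulr1 big1_seq ?addr0 // => i /andP[_].
  rewrite mem_rem_uniq ?fset_uniq // inE => /andP[ne _].
  rewrite (_ : (s == f i) = false) ?mulr0 //; apply: contraNF ne => /eqP->.
  by rewrite fK.
rewrite big1_seq // => i /andP[_ iA].
rewrite (_ : (s == f i) = false) ?mulr0 //; apply: contraNF sA => /eqP->.
by rewrite fK.
Qed.

(** The series of the images of the basis vectors converges coordinatewise in a
    trivial way, as only two terms contribute to each coordinate. It converges in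
    norm because the missing terms come from coordinates of [x] outside of a finite
    set, hence are uniformly small. *)
Lemma extend_sparse f (a b : SYT la -> F) (v : SYT la -> vec F la) x :
  involutive f -> (forall s, abs (a s) <= 1) -> (forall s, abs (b s) <= 1) ->
  (forall s, v s = a s *: evec F (label s) + b s *: evec F (label (f s))) ->
  Shat abs la x ->
  extend abs v x = fun s => a s * x s + b (f s) * x (f s).
Proof.
move=> fK a1 b1 hv Sx; rewrite /extend /vsum.
set y : vec F la := fun s => _.
(* The coordinate at [s] only receives the terms of [s] and of [f s]. *)
have uE (B : {fset SYT la}) s : partial_sum (fun s => x s *: v s) B s =
    (if s \in B then a s * x s else 0) + (if f s \in B then b (f s) * x (f s) else 0).
  rewrite /partial_sum fct_sumE -(big_seq_fsetE _ _ predT (fun i => (x i *: v i) s)) /=.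
  rewrite -(sum_delta B (fun i => a i * x i) id) //.
  rewrite -(sum_delta B (fun i => b i * x i) f) // -big_split /=.
  apply: eq_bigr => i _; rewrite hv.
  rewrite !fctE /GRing.scale /= !evecE /GRing.scale /=.
  by ring.
have dom (c : SYT la -> F) s : abs (c s) <= 1 -> abs (c s * x s) <= abs (x s).
  by move=> h; rewrite (absM habs) ler_piMl // (abs_ge0 habs).
have Sy : Shat abs la y.
  apply: (Shat_dominated f x) => // s; apply: (abs_addr_le habs).
    by rewrite le_max dom.
  by rewrite le_max dom ?orbT.
have Su B : Shat abs la (partial_sum (fun s => x s *: v s) B).
  apply: (Shat_dominated f x) => // s; rewrite uE; apply: (abs_addr_le habs).
    by rewrite le_max; case: ifP => _; rewrite ?dom // (abs0 habs) (abs_ge0 habs).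
  by rewrite le_max; case: ifP => _; rewrite ?dom ?orbT // (abs0 habs) (abs_ge0 habs).
have ty : tends_to (partial_sum (fun s => x s *: v s)) y.
  move=> e e0; have /finite_fsetP[A eA] := Sx e e0.
  exists A => B /fsubsetP AB; apply: vnorm_le => [|s]; first exact: ltW.
  have small r : r \notin B -> abs (x r) <= e.
    move=> rB; apply/ltW; rewrite ltNge; apply/negP => h.
    have : [set s | e <= abs (x s)] r by []; rewrite eA /= => /AB.
    exact/negP.
  rewrite !fctE uE /y opprD addrACA; apply: (abs_addr_le habs).
    case: ifPn => [_|sB]; first by rewrite subrr (abs0 habs) ltW.
    by rewrite sub0r (absN habs); apply: le_trans (dom _ _ _) (small _ sB).
  case: ifPn => [_|sB]; first by rewrite subrr (abs0 habs) ltW.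
  by rewrite sub0r (absN habs); apply: le_trans (dom _ _ _) (small _ sB).
apply: xget_unique; first by split=> //; exact/tends_toP.
move=> z [Sz /tends_toP tz]; exact: tends_to_unique ty tz.
Qed.

End Vectors.

(** * The Hecke operators in coordinates *)

Section Operators.
Context {R : realType} {F : fieldType} {abs : F -> R}.
Hypothesis habs : complete_nonarch abs.
Context {t : F} (ht : 0 < abs t < 1).
Context {la : seq nat} (hla : is_partition la).
Implicit Types (x y : vec F la) (s r : SYT la) (k n : nat).

(** The ratio of the eigenvalues of the Jucys-Murphy element [J_k] at [s] and at
    its swap. The diagonal coefficient of [T_k] at [s], and the product of the two
    off-diagonal ones, are rational functions of it and of [t]. *)
Definition axial s k : F := t ^ (label_content s k.+1 - label_content s k).

Definition Tdiag s k : F := (1 - t) / (1 - axial s k).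

Definition Toff s k : F :=
  if ~~ swappable s k then 0
  else if ((box_at s k.+1).1 < (box_at s k).1)%N
          && ((box_at s k).2 < (box_at s k.+1).2)%N then 1
  else let d := label_content s k - label_content s k.+1 in
    t * ((1 - t ^ (d - 1)) * (1 - t ^ (d + 1)) / (1 - t ^ d) ^+ 2).

Let t0 : t != 0 := t_neq0 habs ht.
Let sub_neq0 n : 1 - t ^+ n.+1 != 0 := sub1tX_neq0 habs ht n.

Lemma axial_inv_neq1 n : 1 - t ^ (- n.+1%:Z) != 0.
Proof.
have := sub_neq0 n; apply: contra_neq => /eqP; rewrite subr_eq0 => /eqP e.
by rewrite -[t ^+ n.+1]invrK exprnN -e invr1 subrr.
Qed.

Lemma axial_neq1 s k : (0 < k)%N -> 1 - axial s k != 0.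
Proof.
move=> k0; rewrite /axial; case: (consecutiveP hla s k k0) => [_|_ _|n _ _|n _ _].
- exact: (sub_neq0 0).
- exact: (axial_inv_neq1 0).
- exact: (sub_neq0 n.+1).
- exact: (axial_inv_neq1 n.+1).
Qed.

Lemma Tdiag_inv n : (1 - t) / (1 - t ^ (- n.+1%:Z)) =
  - (t ^+ n.+1 * ((1 - t) / (1 - t ^+ n.+1))).
Proof.
have tn0 : t ^+ n.+1 != 0 by rewrite expf_neq0.
have h1 := sub_neq0 n; have h2 := axial_inv_neq1 n.
rewrite -exprnN in h2 *.
have h3 : t ^+ n.+1 - 1 != 0 by rewrite -opprB oppr_eq0.
by field; rewrite tn0 h1 h3.
Qed.

Lemma Toff_above s k : ((box_at s k.+1).1 < (box_at s k).1)%N ->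
  ((box_at s k).2 < (box_at s k.+1).2)%N -> swappable s k -> Toff s k = 1.
Proof. by move=> h1 h2 h; rewrite /Toff h h1 h2. Qed.

Lemma Toff_below s k n : ((box_at s k).1 < (box_at s k.+1).1)%N ->
  swappable s k -> label_content s k - label_content s k.+1 = n.+2%:Z ->
  Toff s k = t * ((1 - t ^+ n.+1) * (1 - t ^+ n.+3) / (1 - t ^+ n.+2) ^+ 2).
Proof.
move=> h1 h2 e; rewrite /Toff h2 /= ltnNge (ltnW h1) /= e.
have -> : n.+2%:Z - 1 = n.+1%:Z by lia.
by have -> : n.+2%:Z + 1 = n.+3%:Z by lia.
Qed.

(** One formula covers the four cases: for adjacent labels in a row or a column the
    diagonal coefficient specializes to [1] or [- t]. *)
Lemma T_basisE s k : (0 < k)%N ->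
  T_basis t k (val s) =
  Tdiag s k *: evec F (label s) + Toff s k *: (evec F (label (swap k s)) : vec F la).
Proof.
move=> k0; rewrite /T_basis -/(label s) -!/(box_at s _) /Tdiag /Toff /axial.
rewrite -!/(label_content s _) -(opprB (label_content s k.+1)).
have sw := label_swap s k.
case: (consecutiveP hla s k k0) sw.
- by move=> -> _; rewrite eqxx /= scale0r addr0 expr1z divff ?scale1r ?(sub_neq0 0).
- move=> /eqP/negbTE-> -> _; rewrite eqxx /= scale0r addr0; congr (_ *: _).
  rewrite (Tdiag_inv 0) expr1; have := sub_neq0 0; rewrite expr1 => h.
  by rewrite divff // mulr1.
- move=> n h1 h2 /(_ isT) ->; rewrite (gtn_eqF h1) (ltn_eqF h2) h1 h2 /=.
  by rewrite scale1r addrC.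
- move=> n h1 h2 /(_ isT) ->; rewrite (ltn_eqF h1) (gtn_eqF h2).
  rewrite !(ltnNge _ (box_at s k).1) (ltnW h1) /= opprK (Tdiag_inv n.+1) scaleNr.
  by rewrite addrC.
Qed.

Lemma abs_t_le1 : abs t <= 1.
Proof. by case/andP: ht => _ /ltW. Qed.

Lemma abs_tX_le1 n : abs (t ^+ n) <= 1.
Proof. by rewrite (absX habs) exprn_ile1 ?(abs_ge0 habs) ?abs_t_le1. Qed.

Lemma abs_Tdiag s k : (0 < k)%N -> abs (Tdiag s k) <= 1.
Proof.
have a1 n := abs_1subtX habs ht n.
have tE : abs (1 - t) = 1 by have := a1 0; rewrite expr1.
move=> k0; rewrite /Tdiag /axial; case: (consecutiveP hla s k k0) => [_|_ _|n _ _|n _ _].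
- by rewrite (absM habs) (absV habs) expr1z tE divff ?oner_neq0.
- rewrite (Tdiag_inv 0) (absN habs) !(absM habs) (absV habs) expr1 tE divff ?oner_neq0 //.
  by rewrite mulr1 abs_t_le1.
- by rewrite (absM habs) (absV habs) tE a1 divff ?oner_neq0.
- rewrite (Tdiag_inv n.+1) (absN habs) (absM habs (t ^+ _)) (absM habs (1 - t)).
  rewrite (absV habs) a1 tE divff ?oner_neq0 //.
  by rewrite mulr1 abs_tX_le1.
Qed.

Definition Toff_value n : F :=
  t * ((1 - t ^+ n.+1) * (1 - t ^+ n.+3) / (1 - t ^+ n.+2) ^+ 2).

Lemma Toff_swappable s k : swappable s k -> exists n,
  [/\ Toff s k = 1, Toff (swap k s) k = Toff_value n & axial s k = t ^+ n.+2] \/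
  [/\ Toff s k = Toff_value n, Toff (swap k s) k = 1 & axial s k = t ^ (- n.+2%:Z)].
Proof.
move=> h; have k0 : (0 < k)%N by case/and3P: h.
have h' : swappable (swap k s) k by rewrite swappable_swap.
have b1 : box_at (swap k s) k = box_at s k.+1 by rewrite box_at_swap // sn_eq.
have b2 : box_at (swap k s) k.+1 = box_at s k by rewrite box_at_swap // sn_eqS.
rewrite /axial; move: (h) (opprB (label_content s k.+1) (label_content s k)).
case: (consecutiveP hla s k k0) => // n h1 h2 _ e; exists n; [left|right]; split=> //.
- exact: Toff_above.
- apply: Toff_below => //; first by rewrite b1 b2.
  by rewrite label_content_swap // label_content_swapS // -[LHS]opprB -e opprK.
- by apply: Toff_below => //; rewrite -e opprK.
- by apply: Toff_above => //; rewrite b1 b2.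
Qed.

Lemma abs_Toff_value n : abs (Toff_value n) = abs t.
Proof.
rewrite /Toff_value !(absM habs) (absV habs) (absX habs) !(abs_1subtX habs ht).
by rewrite expr1n invr1 !mulr1.
Qed.

Lemma abs_Toff s k : abs (Toff s k) <= 1.
Proof.
case h : (swappable s k); last by rewrite /Toff h (abs0 habs).
have [n [[-> _ _]|[-> _ _]]] := Toff_swappable s k h; first by rewrite (abs1 habs).
by rewrite abs_Toff_value abs_t_le1.
Qed.

Lemma Toff_neq0 s k : swappable s k -> Toff s k != 0.
Proof.
move=> h; have [n [[-> _ _]|[-> _ _]]] := Toff_swappable s k h; first exact: oner_neq0.
apply/eqP => /(abs_eq0 habs); rewrite abs_Toff_value => e.
by case/andP: ht => +; rewrite e ltxx.
Qed.

(** The product of the two off-diagonal coefficients does not depend on which of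
    the two tableaux is the larger one; it amounts to [det T_k = - t] on the plane
    that they span. *)
Lemma Toff_mul s k : swappable s k ->
  let u := axial s k in
  Toff s k * Toff (swap k s) k = (t - u) * (1 - u * t) / (1 - u) ^+ 2.
Proof.
move=> h; have := sub_neq0; move=> nz.
have [n [[-> -> ->]|[-> -> ->]]] := Toff_swappable s k h => /=; rewrite /Toff_value.
  rewrite mul1r mulrA; congr (_ / _); rewrite !exprS; ring.
have := axial_inv_neq1 n.+1; rewrite -exprnN => nz'.
have := nz n.+1; have tn : t ^+ n.+2 != 0 by rewrite expf_neq0.
rewrite (_ : t ^+ n.+3 = t * t ^+ n.+2); last by rewrite exprS.
have e1 : t ^+ n.+2 = t * t ^+ n.+1 by rewrite exprS.
have tn1 : t ^+ n.+1 != 0 by rewrite expf_neq0.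
move: nz' tn; rewrite e1; move: (t ^+ n.+1) tn1 => v v0 nz' tn nz2.
have nz3 : t * v - 1 != 0 by rewrite -opprB oppr_eq0.
by field; rewrite v0 t0 nz2 nz3.
Qed.

Lemma axial_swap s k : swappable s k -> axial (swap k s) k = (axial s k)^-1.
Proof.
move=> h; rewrite /axial label_content_swap // label_content_swapS //.
by rewrite -opprB -invr_expz.
Qed.

Lemma T_opE k x : (0 < k)%N -> Shat abs la x ->
  T_op abs t k x =
  fun s => Tdiag s k * x s + Toff (swap k s) k * x (swap k s).
Proof.
move=> k0 Sx; apply: (extend_sparse habs (swap k) (Tdiag^~ k) (Toff^~ k)) => //.
- exact: swapK.
- by move=> s; exact: abs_Tdiag.
- by move=> s; exact: abs_Toff.
- by move=> s; exact: T_basisE.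
Qed.

(** * Jucys-Murphy operators *)

(** Here [jucys_murphy n] is the operator [J_(n+1)]. *)
Fixpoint jucys_murphy n : vec F la -> vec F la :=
  if n is n'.+1 then T_op abs t n \o jucys_murphy n' \o T_op abs t n else id.

Variable W : set (vec F la).
Hypothesis WS : W `<=` Shat abs la.
Hypothesis WT : forall k x, (0 < k)%N -> W x -> W (T_op abs t k x).

Lemma jucys_murphy_stable n x : W x -> W (jucys_murphy n x).
Proof. by elim: n x => // n IH x Wx /=; apply: WT => //; apply/IH/WT. Qed.

(** In the plane spanned by a tableau and its swap, [T_k J_k T_k] is computed with
    the diagonal [J_k]; the off-diagonal part cancels. The eigenvalue of [J_1] is 1
    because the label 1 has content 0. *)
Lemma jucys_murphyE n x s : W x ->
  jucys_murphy n x s = t ^ (n%:Z - label_content s n.+1) * x s.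
Proof.
elim: n x s => [|n IH] x s Wx.
  have -> : 0%:Z - label_content s 1 = 0 by have := label_content_bound hla s 1 isT; lia.
  by rewrite expr0z mul1r.
have k0 : (0 < n.+1)%N by []; have WTx := WT _ _ k0 Wx.
rewrite /= T_opE //; last exact/WS/jucys_murphy_stable.
rewrite !IH // !T_opE //; last exact: WS.
rewrite swapK.
case h : (swappable s n.+1).
  have tm := Toff_mul s _ h; have as_ := axial_swap s _ h.
  have nz := axial_neq1 s _ k0; have nz' := axial_neq1 (swap n.+1 s) _ k0.
  rewrite as_ in nz'.
  rewrite label_content_swap // /Tdiag as_.
  have u0 : axial s n.+1 != 0 by rewrite expfz_neq0.
  (* Express all powers of [t] through the eigenvalue [P] of [J_(n+1)] at the
     swapped tableau and the axial ratio [u]. *)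
  set P := t ^ (n%:Z - label_content s n.+2).
  have -> : t ^ (n.+1%:Z - label_content s n.+2) = P * t.
    have -> : n.+1%:Z - label_content s n.+2 = n%:Z - label_content s n.+2 + 1 by lia.
    by rewrite expfzDr // expr1z.
  have -> : t ^ (n%:Z - label_content s n.+1) = P * axial s n.+1.
    by rewrite /P /axial -expfzDr //; congr (_ ^ _); lia.
  move: tm nz nz' u0 => /=.
  move: (axial s n.+1) (Toff s n.+1) (Toff (swap n.+1 s) n.+1) => u b b' bb nz nz' u0.
  move: (x s) (x (swap n.+1 s)) => c c'.
  have -> : (1 - t) / (1 - u^-1) = - (u * ((1 - t) / (1 - u))).
    have nz3 : u - 1 != 0 by rewrite -opprB oppr_eq0.
    by field; rewrite u0 nz nz3.
  (* The identity behind the diagonal entry is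
     [u (1-t)^2 + (t-u) (1-ut) = t (1-u)^2]. *)
  have -> : P * t * c =
      ((1 - t) / (1 - u) * (P * u * ((1 - t) / (1 - u))) +
       P * ((t - u) * (1 - u * t) / (1 - u) ^+ 2)) * c.
    by field.
  rewrite -bb; ring.
rewrite /swap h /Toff h !mul0r !addr0 !mulrA; congr (_ * _).
rewrite /Tdiag /axial; move: h (opprB (label_content s n.+2) (label_content s n.+1)).
case: (consecutiveP hla s _ k0) => // [_|_ _] _ e.
  have -> : n.+1%:Z - label_content s n.+2 = n%:Z - label_content s n.+1 by lia.
  have t1 : 1 - t != 0 by have := sub_neq0 0; rewrite expr1.
  by rewrite expr1z divff // mul1r mulfK.
have t1 : 1 - t != 0 by have := sub_neq0 0; rewrite expr1.
have -> : t ^ (n.+1%:Z - label_content s n.+2) =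
    t ^ (n%:Z - label_content s n.+1) * t ^+ 2.
  rewrite -[t ^+ 2]/(t ^ 2%:Z) -expfzDr //; congr (_ ^ _); lia.
by rewrite -mulrA (Tdiag_inv 0) expr1 divff //; ring.
Qed.

End Operators.

(** * Irreducibility *)

Section Irreducible.
Context {R : realType} {F : fieldType} {abs : F -> R}.
Hypothesis habs : complete_nonarch abs.
Context {t : F} (ht : 0 < abs t < 1).
Context {la : seq nat} (hla : is_partition la).
Implicit Types (x y : vec F la) (s r : SYT la) (k n : nat) (m : SYT la -> F).

Variable W : set (vec F la).
Hypothesis Wsub : is_subspace abs W.
Hypothesis Wclosed : norm_closed abs W.
Hypothesis WT : forall k x, (0 < k)%N -> W x -> W (T_op abs t k x).

Let WS : W `<=` Shat abs la := is_subspace_sub Wsub.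

Lemma subspace_scale (a : F) x : W x -> W (a *: x).
Proof.
move=> Wx; rewrite -[_ *: _]addr0.
exact: (is_subspaceP Wsub _ Wx (is_subspace0 Wsub)).
Qed.

Lemma subspace_sum (A : seq (SYT la)) (c : SYT la -> F) (v : SYT la -> vec F la) :
  (forall s, W (v s)) -> W (\sum_(s <- A) c s *: v s).
Proof.
move=> Wv; elim: A => [|s A IH]; first by rewrite big_nil; exact: is_subspace0 Wsub.
by rewrite big_cons; exact: (is_subspaceP Wsub _ (Wv s) IH).
Qed.

(** Diagonal operators that preserve [W], written as functions on tableaux. *)
Definition multiplier m := forall x, W x -> W (fun s => m s * x s : F).

Lemma multiplier_jucys_murphy n : multiplier (fun s => t ^ (n%:Z - label_content s n.+1)).
Proof.
move=> x Wx; have := jucys_murphy_stable _ WT n _ Wx; congr (W _).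
by apply/funext => s; exact: (jucys_murphyE habs ht hla _ WS WT).
Qed.

Lemma multiplier_affine (a b : F) m : multiplier m -> multiplier (fun s => a * m s + b).
Proof.
move=> Mm x Wx; have := is_subspaceP Wsub a (Mm _ Wx) (subspace_scale b _ Wx).
by congr (W _); apply/funext => s /=; rewrite mulrDl -mulrA.
Qed.

Lemma multiplier_prod (I : Type) (L : seq I) (P : pred I) (m : I -> SYT la -> F) :
  (forall i, multiplier (m i)) -> multiplier (fun s => \prod_(i <- L | P i) m i s).
Proof.
move=> Mm; elim: L => [|i L IH] x Wx.
  by move: (Wx); congr (W _); apply/funext => s; rewrite big_nil mul1r.
case Pi : (P i).
  have := Mm i _ (IH _ Wx); congr (W _); apply/funext => s.
  by rewrite big_cons Pi mulrA.
by have := IH _ Wx; congr (W _); apply/funext => s; rewrite big_cons Pi.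
Qed.

(** Lagrange interpolation at the finitely many possible eigenvalues. *)
Lemma multiplier_content r n :
  multiplier (fun s => (label_content s n.+1 == label_content r n.+1)%:R).
Proof.
pose L := [seq j%:Z - n%:Z | j <- iota 0 (n.*2.+1)].
pose node (c : int) : F := t ^ (n%:Z - c).
(* The Lagrange factor that vanishes at content [c] and is 1 at the content in
   [r], as an affine function of the eigenvalue. *)
pose m c s := (node (label_content r n.+1) - node c)^-1 * node (label_content s n.+1)
               + - node c / (node (label_content r n.+1) - node c).
have Mm c : multiplier (m c) by apply: multiplier_affine; exact: multiplier_jucys_murphy.
have node_neq c : c != label_content r n.+1 -> node (label_content r n.+1) - node c != 0.
  apply: contra_neq => /eqP; rewrite subr_eq0 => /eqP /(exprz_injective habs ht); lia.
move=> x Wx; have := multiplier_prod _ L (fun c => c != label_content r n.+1) m Mm x Wx.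
congr (W _); apply/funext => s; congr (_ * _).
have mE c : m c s =
    (node (label_content s n.+1) - node c) / (node (label_content r n.+1) - node c).
  by rewrite /m; ring.
have [e|ne] := eqVneq (label_content s n.+1) (label_content r n.+1).
  by rewrite big1 // => c /node_neq nz; rewrite mE e divff.
have sL : label_content s n.+1 \in L.
  have bd := label_content_bound hla s n.+1 isT.
  apply/mapP; exists (absz (label_content s n.+1 + n%:Z)); last by lia.
  by rewrite mem_iota; lia.
by rewrite (big_rem _ sL) /= ne mE subrr !mul0r.
Qed.

Lemma subspace_approx x : Shat abs la x ->
  (forall e : R, 0 < e -> exists2 y, W y & forall s, abs (x s - y s) < e) -> W x.
Proof.
move=> Sx h; apply: Wclosed => // e e0.
have [y Wy hy] := h (e / 2) (divr_gt0 e0 (ltr0n _ 2)).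
exists y => //; apply: (@le_lt_trans _ _ (e / 2)); last first.
  by rewrite gtr_pMr // invf_lt1 // ltr1n.
by apply: vnorm_le => [|s]; [rewrite divr_ge0 // ltW|exact/ltW/hy].
Qed.

(** For each of the finitely many tableaux with a large coordinate, choose a label
    whose content tells it from [r]. The product of the corresponding indicator
    functions is 1 at [r], 0 at these tableaux, and at most 1 in absolute value
    elsewhere, where the coordinates of [x] are small. *)
Lemma subspace_evec x r : W x -> x r != 0 -> W (evec F (label r)).
Proof.
move=> Wx xr.
suff : W (x r *: (evec F (label r) : vec F la)).
  by move=> /(subspace_scale (x r)^-1); rewrite scalerA mulVf // scale1r.
apply: subspace_approx => [|e e0]; first exact: Shat_evec.
have /finite_fsetP[A eA] := WS _ Wx e e0.
have sep s : exists k, s != r -> label_content s k.+1 != label_content r k.+1.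
  have [->|ne] := eqVneq s r; first by exists 0%N.
  apply: contrapT => h; case/eqP: ne; apply: (label_content_ext hla) => -[//|k] _.
  by apply: contrapT => /eqP ne; apply: h; exists k.
have [K sepK] := choice sep.
have := multiplier_prod _ A (fun s => s != r)
  (fun s s' => (label_content s' (K s).+1 == label_content r (K s).+1)%:R)
  (fun s => multiplier_content r (K s)) x Wx.
set y : vec F la := fun s => _ => Wy; exists y => // s.
rewrite {1}/GRing.scale /= evecE /GRing.scale /=.
have [->|ne] := eqVneq s r.
  rewrite /y big1; last by move=> i _; rewrite eqxx.
  by rewrite mulr1 mul1r subrr (abs0 habs).
rewrite mulr0 sub0r (absN habs) /y.
have [sA|sA] := boolP (s \in A).
  by rewrite (big_rem _ sA) /= ne (negbTE (sepK _ ne)) !mul0r (abs0 habs).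
have small : abs (x s) < e.
  rewrite ltNge; apply: contraNN sA => h.
  by have : [set s | e <= abs (x s)] s by []; rewrite eA.
apply: le_lt_trans small; rewrite (absM habs) ler_piMl ?(abs_ge0 habs) //.
elim/big_ind: _ => [|a b ha hb|i _]; rewrite ?(abs1 habs) //.
  by rewrite (absM habs) mulr_ile1 ?(abs_ge0 habs).
by case: eqP => _; rewrite ?(abs1 habs) ?(abs0 habs) ?ler01.
Qed.

Lemma subspace_swap s k : swappable s k -> W (evec F (label s)) ->
  W (evec F (label (swap k s))).
Proof.
move=> h We; have k0 : (0 < k)%N by case/and3P: h.
apply: (subspace_evec (T_op abs t k (evec F (label s)))); first exact: WT.
rewrite T_opE //; last exact: WS.
rewrite /= swapK !evecE eqxx mulr1.
rewrite (_ : (swap k s == s) = false); last first.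
  apply/eqP => e; have := axial_neq1 habs ht hla s k k0.
  have := label_content_swap s k h; rewrite e /axial => ->.
  by rewrite subrr expr0z subrr eqxx.
by rewrite mulr0 add0r; exact: (Toff_neq0 habs ht hla s k h).
Qed.

(** A null family is the limit of its finite truncations. *)
Lemma subspace_full x r : W x -> x r != 0 -> W = Shat abs la.
Proof.
move=> Wx xr; apply/seteqP; split=> // y Sy.
have We s : W (evec F (label s)).
  apply: (swap_connected hla (fun s => W (evec F (label s))) _ s r).
    by move=> ? ?; exact: subspace_swap.
  exact: subspace_evec xr.
apply: subspace_approx => // e e0; have /finite_fsetP[A eA] := Sy e e0.
exists (\sum_(s <- A) y s *: (evec F (label s) : vec F la)); first exact: subspace_sum.
move=> s; have -> : (\sum_(i <- A) y i *: (evec F (label i) : vec F la)) s =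
    if s \in A then y s else 0.
  rewrite fct_sumE -(sum_delta A y id) //.
have [sA|sA] := boolP (s \in A); first by rewrite subrr (abs0 habs).
rewrite subr0 ltNge; apply: contraNN sA => h.
by have : [set s | e <= abs (y s)] s by []; rewrite eA.
Qed.

End Irreducible.

Theorem proposition3p12 (R : realType) (F : fieldType) (abs : F -> R)
  (habs : complete_nonarch abs) (t : F) (ht : 0 < abs t < 1)
  (la : seq nat) (hla : is_partition la) :
  forall W : set (vec F la),
    is_subspace abs W -> norm_closed abs W -> Hhat_invariant abs t W ->
    W = [set 0] \/ W = Shat abs la.
Proof.
move=> W Wsub Wclosed [WT _].
have [[x Wx [r xr]]|h] := pselect (exists2 x, W x & exists r, x r != 0).
  by right; apply: (subspace_full habs ht hla W _ _ _ x r).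
left; apply/seteqP; split=> [x Wx|_ ->]; last exact: is_subspace0 Wsub.
apply/funext => r; apply/eqP/negPn/negP => xr.
by apply: h; exists x => //; exists r.
Qed.
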